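(* Let $p$ be a prime distinct from $2,3,5$, let $\mathbb{F}_p$ be the field with $p$ elements, and let $G$ be one of the groups $\mathbf{SL}(2,\mathbb{F}_p)$ or $\mathbf{PSL}(2,\mathbb{F}_p)$. Then there is an unmixed Beauville surface with group $G$, that is, there is an unmixed Beauville structure $v$ on $G$, with associated unmixed Beauville surface $S(v)$.
   Context: For a finite group $G$ and $a,c\in G$ put $\Sigma(a,c)=\bigcup_{g\in G}\bigcup_{i\ge 0}\{ga^ig^{-1},\,gc^ig^{-1},\,g(ac)^ig^{-1}\}$. An unmixed Beauville structure on $G$ is a quadruple $v=(a_1,c_1;a_2,c_2)$ of elements of $G$ such that $\langle a_1,c_1\rangle=G$, $\langle a_2,c_2\rangle=G$ and $\Sigma(a_1,c_1)\cap\Sigma(a_2,c_2)=\{1_G\}$. The curve $C(a,c)$: let $(a,c)$ generate $G$, let $B=\{-1,0,1\}\subset\mathbb{P}^1_{\mathbb{C}}$, and take $\infty$ as base point. Let $\alpha$ be the loop going from $\infty$ along the real line through $-2$ to $-1-\epsilon$, making one full counterclockwise turn around the circle of centre $-1$ and radius $\epsilon$, and returning the same way; let $\gamma$ be the loop going from $\infty$ along the real line through $2$ to $1+\epsilon$, making one full counterclockwise turn around the circle of centre $1$ and radius $\epsilon$, and returning the same way. Then $\alpha,\gamma$ freely generate $\pi_1(\mathbb{P}^1_{\mathbb{C}}-B,\infty)$ (the product $\gamma\circ\delta$ of loops means first $\delta$, then $\gamma$), and $\alpha\mapsto a$, $\gamma\mapsto c$ defines a surjective homomorphism $m$ onto $G$.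 By Riemann's existence theorem it determines a connected compact Riemann surface $C(a,c)$ with a Galois covering $C(a,c)\to\mathbb{P}^1_{\mathbb{C}}$ with group $G$, ramified only over $B$: the fibre over $\infty$ is identified with $G$, a loop $\delta$ acts on it by left translation by $m(\delta)$, and $g\in G$ acts as the deck transformation $h\mapsto hg^{-1}$ on this fibre. For $v=(a_1,c_1;a_2,c_2)$ an unmixed Beauville structure, $S(v)=(C(a_1,c_1)\times C(a_2,c_2))/G$ is the quotient by the diagonal action, which is free; $S(v)$ is called an unmixed Beauville surface with group $G$. *)

(* Defs.v *)
From HB Require Import structures.
From mathcomp Require Import all_boot all_order all_algebra all_fingroup.
From mathcomp Require Import all_solvable.
From mathcomp Require Import generic_quotient complex.
From mathcomp Require Import all_classical all_reals all_analysis.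

Set Implicit Arguments.
Unset Strict Implicit.
Unset Printing Implicit Defensive.

Import Order.TTheory GRing.Theory Num.Theory.
Import GroupScope.

(* A finite group is a finGroupType G; the whole group is [set: G]. *)

Definition SL2_set (p : nat) : {set {'GL_2['F_p]}} :=
  [set A | (\det (GLval A) == 1)%R]%SET.

Lemma SL2_group_set (p : nat) : group_set (SL2_set p).
Proof.
apply/group_setP; split=> [|A B]; first by rewrite inE GL_1E det1.
by rewrite !inE GL_ME => /eqP dA /eqP dB; rewrite det_mulmx dA dB mul1r.
Qed.

Definition SL2_group (p : nat) : {group {'GL_2['F_p]}} :=
  Group (SL2_group_set p).

Definition SL2 (p : nat) : finGroupType := subg_of (SL2_group p).

(* The elements of coset_of H are the cosets of H in its normaliser; the
   centre being normal, this is the full quotient of SL2 by its centre. *)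
Definition PSL2 (p : nat) : finGroupType := coset_of 'Z([set: SL2 p]).

Section BeauvilleStructure.
Context (G : finGroupType).
Implicit Types a c : G.

(* A :^ g^-1 is g A g^-1 *)
Definition Sigma a c : {set G} :=
  \bigcup_(g in [set: G]) (<[a]> :|: <[c]> :|: <[a * c]>) :^ g^-1.

Record quadruple := Quadruple { a1 : G; c1 : G; a2 : G; c2 : G }.

Definition unmixed_beauville_structure (v : quadruple) : Prop :=
  [/\ <<[set a1 v; c1 v]%SET>> = [set: G],
      <<[set a2 v; c2 v]%SET>> = [set: G] &
      Sigma (a1 v) (c1 v) :&: Sigma (a2 v) (c2 v) = 1].

End BeauvilleStructure.

Local Open Scope classical_set_scope.
Local Open Scope ring_scope.

Section AnalyticSpace.
Context (R : realType).

(* A complex space is a topological space with its sheaf of holomorphic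
   functions: holo U f means that U is open and that f is holomorphic on U
   (the values of f outside U are irrelevant). *)
Record analytic_space := AnalyticSpace {
  space :> topologicalType;
  holo : set space -> (space -> R[i]^o) -> Prop }.

Definition biholomorphic (X Y : analytic_space) : Prop :=
  exists (f : X -> Y) (g : Y -> X),
    [/\ cancel f g, cancel g f, continuous f, continuous g &
        forall (U : set Y) (u : Y -> R[i]^o),
          holo U u <-> holo (f @^-1` U) (u \o f)].

(* Continuous and separately holomorphic: by Osgood's lemma this is the usual
   notion when X and Y are complex manifolds. *)
Definition prod_holo (X Y : analytic_space) (W : set (X * Y))
    (f : X * Y -> R[i]^o) : Prop :=
  [/\ open W, {within W, continuous f},
      forall y, holo [set x | W (x, y)] (fun x => f (x, y)) &
      forall x, holo [set y | W (x, y)] (fun y => f (x, y))].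

End AnalyticSpace.

Definition P1 (R : realType) := one_point_compactification R[i]^o.

(* The Galois covering C(a, c) of P1 with monodromy alpha |-> a, gamma |-> c, as
   an explicit gluing. The complement of the real segment [-1, 1] in P1 is simply
   connected and contains the base point oo, so over it the covering is a
   disjoint union of sheets, labelled by the points h : G of the fibre over oo.
   The loop alpha crosses [-1, 1] once, in ]-1, 0[ and from below, and lifts to a
   path from sheet h to sheet a * h; gamma crosses [-1, 1] once, in ]0, 1[ and
   from above, and lifts to a path from sheet h to sheet c * h. So
   - along ]-1, 0[, the lower side of sheet h is glued to the upper side of
     sheet a * h;
   - along ]0, 1[, the upper side of sheet h is glued to the lower side of
     sheet c * h.
   A point over ]-1, 0[ or ]0, 1[ is labelled by the sheet whose upper side
   contains it. A point over -1, 0 or 1 is an orbit of the local monodromy on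
   these labels, that is, a right coset of <[a]>, <[a * c]> or <[c]>; a point
   elsewhere is a coset of the trivial group, that is, a single label. *)
Section Curve.
Context (R : realType) (G : finGroupType) (a c : G).

Definition inertia (z : P1 R) : {group G} :=
  if z == Some (-1) then <[a]>%G
  else if z == Some 0 then <[(a * c)%g]>%G
  else if z == Some 1 then <[c]>%G
  else 1%G.

Definition curve_pred (x : P1 R * {set G}) : bool :=
  x.2 \in rcosets (inertia x.1) [set: G]%SET.

Definition curve : Type := {x | curve_pred x}.

HB.instance Definition _ := Choice.on curve.

Definition curve_proj (x : curve) : P1 R := (val x).1.

Lemma curve_point_subproof (z : P1 R) (h : G) :
  curve_pred (z, inertia z :* h).
Proof. by apply/rcosetsP; exists h; rewrite ?inE. Qed.

Definition curve_point (z : P1 R) (h : G) : curve :=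
  exist curve_pred _ (curve_point_subproof z h).

Definition upper_half : set (P1 R) :=
  [set z | if z is Some w then 0 <= complex.Im w else True].
Definition lower_half : set (P1 R) :=
  [set z | if z is Some w then complex.Im w <= 0 else True].

(* lower_sheet h z lies over z on the lower side of sheet h; crossing z * h is its
   label, which differs from h only when z is on the segment [-1, 1].
   The order of R[i] relates only numbers with the same imaginary part, so the
   inequalities below force w to be real. *)
Definition crossing (z : P1 R) : G :=
  if z is Some w then
    if -1 <= w <= 0 then a else if 0 < w <= 1 then c^-1%g else 1%g
  else 1%g.

Definition upper_sheet (h : G) (z : P1 R) : curve := curve_point z h.
Definition lower_sheet (h : G) (z : P1 R) : curve :=
  curve_point z (crossing z * h)%g.

(* The topology obtained by gluing the closed half sheets. *)
Definition curve_open : set_system curve := [set U | forall h : G,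
  open (upper_sheet h @^-1` U : set (subspace upper_half)) /\
  open (lower_sheet h @^-1` U : set (subspace lower_half))].

Lemma curve_openT : curve_open setT.
Proof. by move=> h; rewrite !preimage_setT; split; exact: openT. Qed.

Lemma curve_openI : setI_closed curve_open.
Proof.
move=> U V oU oV h; have [oU1 oU2] := oU h; have [oV1 oV2] := oV h.
by split; rewrite preimage_setI; exact: openI.
Qed.

Lemma curve_open_bigU (I : Type) (f : I -> set curve) :
  (forall i, curve_open (f i)) -> curve_open (\bigcup_i f i).
Proof.
move=> of_ h; split; rewrite preimage_bigcup; apply: bigcup_open => i _;
by have [] := of_ i h.
Qed.

HB.instance Definition _ :=
  isOpenTopological.Build curve curve_openT curve_openI curve_open_bigU.

(* The projection is a local coordinate except over -1, 0, 1 and oo, where by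
   Riemann's theorem on removable singularities continuity suffices. The
   function s below is a local section of the projection. *)
Definition curve_holo (U : set curve) (f : curve -> R[i]^o) : Prop :=
  [/\ open U, {within U, continuous f} &
      forall (s : R[i]^o -> curve) (w : R[i]^o),
        w \notin [:: -1; 0; 1] -> U (s w) ->
        (\forall t \near w, {for t, continuous s} /\ curve_proj (s t) = Some t) ->
        derivable (f \o s) w 1].

Definition curve_space : analytic_space R := AnalyticSpace curve_holo.

Lemma deck_subproof (g : G) (x : curve) :
  curve_pred ((val x).1, (val x).2 :* g^-1%g).
Proof.
case: x => -[z A] /= /rcosetsP[h _ /= ->]; apply/rcosetsP.
by exists (h * g^-1)%g; rewrite ?inE // rcosetM.
Qed.

(* Over oo, where A = [set h], this is h |-> h * g^-1. *)
Definition deck (g : G) (x : curve) : curve := exist curve_pred _ (deck_subproof g x).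

Lemma deck1 x : deck 1%g x = x.
Proof. by apply: val_inj; rewrite /= invg1 rcoset1; case: (val x). Qed.

Lemma deckM g h x : deck (g * h)%g x = deck g (deck h x).
Proof. by apply: val_inj; rewrite /= invMg rcosetM. Qed.

End Curve.

Section Surface.
Local Open Scope quotient_scope.
Context (R : realType) (G : finGroupType) (v : quadruple G).

Local Notation C1 := (curve_space R (a1 v) (c1 v)).
Local Notation C2 := (curve_space R (a2 v) (c2 v)).

Definition same_orbit : rel (C1 * C2) :=
  fun x y => [exists g : G, y == (deck g x.1, deck g x.2)].

Lemma same_orbit_equiv : equiv_class_of same_orbit.
Proof.
split=> [x|x y|y x z].
- by apply/existsP; exists 1%g; rewrite !deck1; case: x => ? ? /=.
- apply/idP/idP => /existsP[g /eqP->]; apply/existsP; exists g^-1%g;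
  by rewrite /= -!deckM mulVg !deck1 -surjective_pairing.
- move=> /existsP[g /eqP->] /existsP[h /eqP->].
  by apply/existsP; exists (h * g)%g; rewrite !deckM.
Qed.

Canonical same_orbit_equiv_rel := EquivRelPack same_orbit_equiv.

Definition orbits : topologicalType :=
  quotient_topology {eq_quot same_orbit_equiv_rel}.

Definition orbit_of (x : C1 * C2) : orbits := 
  \pi_{eq_quot same_orbit_equiv_rel} x.

Definition orbits_holo (V : set orbits) (f : orbits -> R[i]^o) : Prop :=
  prod_holo (orbit_of @^-1` V) (f \o orbit_of).

Definition beauville_surface : analytic_space R := AnalyticSpace orbits_holo.

End Surface.

Definition unmixed_beauville_surface (R : realType) (G : finGroupType)
    (S : analytic_space R) : Prop :=
  exists v : quadruple G,
    unmixed_beauville_structure v /\ biholomorphic S (beauville_surface R v).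

(* Main.v *)
Require Import Defs.
From HB Require Import structures.
From mathcomp Require Import all_boot all_order all_algebra all_fingroup.
From mathcomp Require Import all_solvable finfield ring zify.
From mathcomp Require Import all_reals.

(** A surface is biholomorphic to itself, so the whole content is the existence
    of an unmixed Beauville structure on SL(2,p) and PSL(2,p). The plan is to
    give SL(2,p) two generating triples (a, c, ac) and (b, d, bd) whose elements
    have exponents m and n with m and n coprime. Then no nontrivial power of the
    first triple can be conjugate to a power of the second one
    ([beauville_of_coprime_exponents]), and since such data survive in every
    quotient, PSL(2,p) follows from SL(2,p) ([coprime_beauville_coset]).

    The exponents are controlled by traces. If A in SL(2,p) has trace x, then
    2A = x + N with N^2 = x^2 - 4, and the Frobenius map shows that A^p is A or
    A^-1 according to the quadratic character of x^2 - 4 when this is nonzero; so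
    A^(p-1) = 1 in the first case and A^(p+1) = 1 in the second
    ([mx2_exp_split], [mx2_exp_nonsplit]).

    The first triple consists of two transvections, of order p, whose product has
    odd order n. The second one is (b, ub, bub) with u a transvection; its traces
    are x, y and xy - 2. Both generate because they contain transvections with
    different axes, and two such transvections generate SL(2,p) by the Bruhat
    decomposition ([transvections_gen]). It remains to choose the traces. With
    x = -10/13 and y = -8/5 one has xy - 2 = x, and x^2 - 4 and y^2 - 4 are both
    the opposite of a nonzero square. So the exponent of the second triple is the one of p - 1 and p + 1
    that 4 divides, while the other is 2n with n odd; this n is an exponent for
    the product in the first triple, if its trace is well chosen
    ([exists_trace_transvections]), and pn is coprime to the exponent of the
    second triple. Only p = 13 escapes, as -10/13 makes no sense there; the
    traces 3, 6, 3 then do, with exponent 14 against 39. *)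

Set Implicit Arguments.
Unset Strict Implicit.
Unset Printing Implicit Defensive.
Import GRing.Theory.

Lemma biholomorphic_refl (R : realType) (X : analytic_space R) :
  biholomorphic X X.
Proof. by exists id, id; split=> // x; exact: filter.cvg_id. Qed.

(** * Generating triples with coprime exponents *)

Section CoprimeExponents.
Local Open Scope group_scope.
Implicit Type G : finGroupType.

Definition exponent_triple G (m : nat) (a c : G) : Prop :=
  [/\ a ^+ m = 1, c ^+ m = 1 & (a * c) ^+ m = 1].

Lemma expg_Sigma G m (a c x : G) :
  exponent_triple m a c -> x \in Sigma a c -> x ^+ m = 1.
Proof.
case=> am cm acm /bigcupP[g _]; rewrite mem_conjg invgK => xg.
apply: (conjg_inj g); rewrite conj1g conjXg; move: xg.
by rewrite !inE -orbA => /or3P[] /cycleP[i ->];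
   rewrite -expgnA mulnC expgnA ?am ?cm ?acm expg1n.
Qed.

Lemma Sigma1 G (a c : G) : 1 \in Sigma a c.
Proof. by apply/bigcupP; exists 1; rewrite ?mem_conjg ?conj1g ?inE ?group1. Qed.

Definition coprime_beauville G : Prop :=
  exists m n (a c b d : G), [/\ coprime m n,
    exponent_triple m a c, exponent_triple n b d,
    <<[set a; c]>> = [set: G] & <<[set b; d]>> = [set: G]].

Lemma beauville_of_coprime_exponents G :
  coprime_beauville G -> exists v : quadruple G, unmixed_beauville_structure v.
Proof.
case=> m [n [a [c [b [d [co_mn ac bd gen1 gen2]]]]]].
exists (Quadruple a c b d); split=> //=; apply/setP=> x; rewrite inE in_set1.
apply/andP/eqP=> [[/(expg_Sigma ac) xm /(expg_Sigma bd) xn] | ->].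
  apply/eqP; rewrite -order_eq1 -dvdn1 -(eqnP co_mn) dvdn_gcd !order_dvdn.
  by rewrite xm xn eqxx.
by rewrite !Sigma1.
Qed.

Section Quotient.
Variables (G : finGroupType) (Z : {group G}).
Hypothesis nZ : Z <| [set: G].

Let inN x : x \in 'N(Z).
Proof. by apply: (subsetP (normal_norm nZ)); rewrite inE. Qed.

Lemma exponent_triple_coset m (a c : G) :
  exponent_triple m a c -> exponent_triple m (coset Z a) (coset Z c).
Proof.
by case=> am cm acm; split; rewrite -?morphM -?morphX ?inN // ?am ?cm ?acm morph1.
Qed.

Lemma gen2_coset (a c : G) : <<[set a; c]>> = [set: G] ->
  <<[set coset Z a; coset Z c]>> = [set: coset_of Z].
Proof.
move=> gen; rewrite -quotientT -gen quotientE morphim_gen.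
  by rewrite morphimU !morphim_set1 ?inN.
by apply/subsetP=> x _; rewrite inN.
Qed.

Lemma coprime_beauville_coset :
  coprime_beauville G -> coprime_beauville (coset_of Z).
Proof.
case=> m [n [a [c [b [d [co_mn ac bd gen1 gen2]]]]]].
exists m, n, (coset Z a), (coset Z c), (coset Z b), (coset Z d).
by split; [|exact: exponent_triple_coset..|exact: gen2_coset|exact: gen2_coset].
Qed.

End Quotient.
End CoprimeExponents.

(** * Two by two matrices *)

Local Open Scope ring_scope.

(** Locked: over ['F_p] with [p] a variable, comparing two unfolded matrices by
    conversion is not feasible. *)
HB.lock Definition mx2 (F : Type) (a b c d : F) : 'M[F]_2 :=
  \matrix_(i, j) if i == 0 then if j == 0 then a else b
                 else if j == 0 then c else d.

Section Mx2Ring.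
Variable F : comNzRingType.
Implicit Types (a b c d : F) (A : 'M[F]_2).

Lemma mx2_entry a b c d i j :
  mx2 a b c d i j = if i == 0 then if j == 0 then a else b
                    else if j == 0 then c else d.
Proof. by rewrite mx2.unlock mxE. Qed.

Lemma mx2_eta A : A = mx2 (A 0 0) (A 0 1) (A 1 0) (A 1 1).
Proof.
apply/matrixP=> i j; rewrite mx2_entry.
by case: i j => [[|[|//]] ?] [[|[|//]] ?] /=; congr (A _ _); apply: val_inj.
Qed.

Lemma mulmx2 a b c d a' b' c' d' :
  mx2 a b c d *m mx2 a' b' c' d' =
  mx2 (a * a' + b * c') (a * b' + b * d') (c * a' + d * c') (c * b' + d * d').
Proof.
apply/matrixP=> i j.
rewrite mx2_entry mxE !big_ord_recl big_ord0 addr0 !mx2_entry /=.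
by case: (i == 0); case: (j == 0).
Qed.

Lemma det_mx2 a b c d : \det (mx2 a b c d) = a * d - b * c.
Proof.
rewrite (expand_det_row _ 0) !big_ord_recl big_ord0 addr0 /cofactor !det_mx11.
by rewrite !mxE !mx2_entry /= expr0 expr1; ring.
Qed.

Lemma mxtrace_mx2 a b c d : \tr (mx2 a b c d) = a + d.
Proof. by rewrite /mxtrace !big_ord_recl big_ord0 addr0 !mx2_entry. Qed.

Lemma scalar_mx2 a : a%:M = mx2 a 0 0 a.
Proof. by rewrite [LHS]mx2_eta !mxE. Qed.

Lemma add_mx2 a b c d a' b' c' d' :
  mx2 a b c d + mx2 a' b' c' d' = mx2 (a + a') (b + b') (c + c') (d + d').
Proof. by rewrite [LHS]mx2_eta !mxE !mx2_entry. Qed.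

Lemma opp_mx2 a b c d : - mx2 a b c d = mx2 (- a) (- b) (- c) (- d).
Proof. by rewrite [LHS]mx2_eta !mxE !mx2_entry. Qed.

Lemma scale_mx2 k a b c d : k *: mx2 a b c d = mx2 (k * a) (k * b) (k * c) (k * d).
Proof. by rewrite [LHS]mx2_eta !mxE !mx2_entry. Qed.

Definition mx2E :=
  (mulmx2, det_mx2, mxtrace_mx2, scalar_mx2, add_mx2, opp_mx2, scale_mx2).

Lemma mx2_1 : 1 = mx2 1 0 0 1 :> 'M[F]_2.
Proof. by rewrite -scalar_mx2. Qed.

Lemma sqr_traceless_part A :
  (2 *: A - (\tr A)%:M) *m (2 *: A - (\tr A)%:M) = ((\tr A) ^+ 2 - 4 * \det A)%:M.
Proof. by rewrite (mx2_eta A) !mx2E; congr (mx2 _ _ _ _); ring. Qed.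

Lemma mulmx_adj2 A : ((\tr A)%:M - A) *m A = (\det A)%:M.
Proof. by rewrite (mx2_eta A) !mx2E; congr (mx2 _ _ _ _); ring. Qed.

Definition upper b : 'M[F]_2 := mx2 1 b 0 1.
Definition lower b : 'M[F]_2 := mx2 1 0 b 1.

Lemma det_upper b : \det (upper b) = 1.
Proof. by rewrite mx2E; ring. Qed.

Lemma det_lower b : \det (lower b) = 1.
Proof. by rewrite mx2E; ring. Qed.

Lemma upperX b n : upper b ^+ n = upper (b *+ n).
Proof.
elim: n => [|n IHn]; first by rewrite [LHS]mx2_1 mulr0n.
rewrite exprS IHn -[LHS]/(_ *m _) mx2E mulrS.
by congr (mx2 _ _ _ _); ring.
Qed.

Lemma lowerX b n : lower b ^+ n = lower (b *+ n).
Proof.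
elim: n => [|n IHn]; first by rewrite [LHS]mx2_1 mulr0n.
rewrite exprS IHn -[LHS]/(_ *m _) mx2E mulrS.
by congr (mx2 _ _ _ _); ring.
Qed.

Lemma mul_upper_lower t : upper 1 *m lower t = mx2 (1 + t) 1 t 1.
Proof. by rewrite mx2E; congr (mx2 _ _ _ _); ring. Qed.

End Mx2Ring.

Section Mx2Field.
Variable F : fieldType.
Implicit Types (a b c d x r t : F) (M : 'M[F]_2).

(** The big Bruhat cell: every unimodular matrix that moves the line fixed by the
    upper transvections is a product of three transvections. *)
Lemma big_cell M : \det M = 1 -> M 1 0 != 0 ->
  M = upper ((M 0 0 - 1) / M 1 0) *m
        (lower (M 1 0) *m upper ((M 1 1 - 1) / M 1 0)).
Proof.
rewrite (mx2_eta M) mx2E !mx2_entry /=.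
move: (M 0 0) (M 0 1) (M 1 0) (M 1 1) => a b c d dM c0.
rewrite !mx2E; congr (mx2 _ _ _ _); try by field.
by apply: (mulIf c0); rewrite (_ : b * c = a * d - 1); [field | rewrite -dM; ring].
Qed.

(** The lower left entry [r] is left free: it makes the trace of
    [upper 1 *m companion x r] equal to [x + r], hence arbitrary. *)
Definition companion x r : 'M[F]_2 := mx2 0 (- r^-1) r x.

Lemma det_companion x r : r != 0 -> \det (companion x r) = 1.
Proof. by move=> r0; rewrite mx2E; field. Qed.

Lemma mxtrace_companion x r : \tr (companion x r) = x.
Proof. by rewrite mx2E add0r. Qed.

Lemma mxtrace_upper_companion x r : \tr (upper 1 *m companion x r) = x + r.
Proof. by rewrite !mx2E; ring. Qed.

Lemma mxtrace_companion_upper_companion x r : r != 0 ->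
  \tr (companion x r *m (upper 1 *m companion x r)) = x * (x + r) - 2.
Proof. by move=> r0; rewrite !mx2E; field. Qed.

Lemma companion_mul_upper x r :
  r != 0 -> companion 0 r *m upper (x / r) = companion x r.
Proof. by move=> r0; rewrite mx2E; congr (mx2 _ _ _ _); field. Qed.

Lemma companion_conj_upper r :
  r != 0 -> lower (- r ^+ 2) *m companion 0 r = companion 0 r *m upper 1.
Proof. by move=> r0; rewrite !mx2E; congr (mx2 _ _ _ _); field. Qed.

(** By Cayley-Hamilton, (C + 1)^2 = (tr C + 2) C when det C = 1; for a trace
    tau^2 - 2 this makes (C + 1) / tau a square root of C, of trace tau. *)
Lemma sqrt_mul_upper_lower tau : tau != 0 ->
  exists M, [/\ \det M = 1, \tr M = tau &
                M ^+ 2 = upper 1 *m lower (tau ^+ 2 - 4)].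
Proof.
move=> tau0; rewrite mul_upper_lower; set t := _ - 4.
exists (mx2 ((2 + t) / tau) (1 / tau) (t / tau) (2 / tau)).
split; last rewrite expr2 -[LHS]/(_ *m _).
- by rewrite mx2E /t; field.
- by rewrite mx2E /t; field.
by rewrite mx2E /t; congr (mx2 _ _ _ _); field.
Qed.

Lemma four_sub_sqr a b : a + b != 0 ->
  4 - (2 * (a - b) / (a + b)) ^+ 2 = (4 / (a + b)) ^+ 2 * (a * b).
Proof. by move=> ab0; field. Qed.

(** The condition xy - 2 = x gives y = 1 + 2/x, and then, with w = (x+2)/(x-2),
    the elements x^2 - 4 and y^2 - 4 are w and -(2w + 1) up to squares. Taking
    w = - v^2 they are opposites of squares if 1 - 2 v^2 is a square; v = 2/3 is
    such a choice. *)
Lemma rational_traces (x := - 10 / 13 : F) (y := - 8 / 5 : F) :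
  5 != 0 :> F -> 13 != 0 :> F ->
  [/\ x - y = 2 * 3 ^+ 3 / (5 * 13), x * y - 2 = x,
      x ^+ 2 - 4 = - (2 ^+ 3 * 3 / 13) ^+ 2 & y ^+ 2 - 4 = - (2 * 3 / 5) ^+ 2].
Proof.
move=> five0 thirteen0; rewrite /x /y.
have p0 : 65 != 0 :> F by rewrite (natrM _ 5 13) mulf_neq0.
by split; field; rewrite ?p0 ?five0 ?thirteen0.
Qed.

End Mx2Field.

(** * Orders of elements and quadratic characters *)

Section Characters.
Variable p : nat.
Hypothesis pr_p : prime p.
Hypothesis p_gt3 : (3 < p)%N.

Let odd_p : odd p.
Proof. by case: (even_prime pr_p) => // p2; move: p_gt3; rewrite p2. Qed.

Let p_half : p = (p./2.*2).+1.
Proof. by rewrite -[LHS]odd_double_half odd_p. Qed.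

Lemma natr_Fp_neq0 n : ~~ (p %| n)%N -> n%:R != 0 :> 'F_p.
Proof. by rewrite (dvdn_pcharf (pchar_Fp pr_p)). Qed.

Let two_neq0 : 2 != 0 :> 'F_p.
Proof. by rewrite natr_Fp_neq0 // gtnNdvd // ltnW. Qed.

Lemma Fermat_Fp (x : 'F_p) : x ^+ p = x.
Proof. by rewrite -[X in x ^+ X = _](card_Fp pr_p) expf_card. Qed.

Lemma sqr_half_exp (x : 'F_p) : x != 0 -> (x ^+ 2) ^+ p./2 = 1.
Proof.
move=> x0; apply: (mulIf x0); rewrite mul1r -exprM mul2n -exprSr.
by rewrite -[RHS]Fermat_Fp; congr (_ ^+ _); rewrite [in RHS]p_half.
Qed.

Lemma half_exp_sign (x : 'F_p) : x != 0 -> x ^+ p./2 = 1 \/ x ^+ p./2 = - 1.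
Proof.
move=> x0; have /eqP := sqr_half_exp x0.
by rewrite exprAC sqrf_eq1 => /orP[]/eqP; [left | right].
Qed.

(** Write 2A = tr A + N with N traceless. The two summands commute, so Frobenius
    is additive on them, and N^2 is the scalar (tr A)^2 - 4 det A, so N^p is N
    times the power of this scalar that gives its quadratic character. *)
Lemma Frobenius_mx2 (A : 'M['F_p]_2) :
  2 *: A ^+ p = (\tr A)%:M
    + ((\tr A) ^+ 2 - 4 * \det A) ^+ p./2 *: (2 *: A - (\tr A)%:M).
Proof.
have := sqr_traceless_part A.
set x := \tr A; set N := 2 *: A - x%:M; set d := x ^+ 2 - _ => NN.
have pA : p \in [pchar 'M['F_p]_2] by rewrite pchar_lalg pchar_Fp.
have Np : N ^+ p = d ^+ p./2 *: N.
  have -> : N ^+ p = N ^+ (p./2.*2).+1 by congr (_ ^+ _).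
  by rewrite exprS -mul2n exprM expr2 [N * N]NN -rmorphXn -mul_mx_scalar.
have -> : 2 *: A ^+ p = (2 *: A) ^+ p by rewrite exprZn Fermat_Fp.
have -> : 2 *: A = x%:M + N by rewrite /N addrC subrK.
have cxN : GRing.comm x%:M N by exact: comm_scalar_mx.
have := pFrobenius_autD_comm pA cxN.
by rewrite !pFrobenius_autE => ->; rewrite Np -rmorphXn Fermat_Fp.
Qed.

Lemma mx2_exp_split (A : 'M['F_p]_2) : \det A = 1 ->
  ((\tr A) ^+ 2 - 4) ^+ p./2 = 1 -> A ^+ p.-1 = 1.
Proof.
move=> dA; have := Frobenius_mx2 A; rewrite dA mulr1 => + e1.
rewrite e1 scale1r addrC subrK => /(scalerI two_neq0) Ap.
have uA : A \is a GRing.unit.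
  by rewrite -[_ \is a _]/(A \in unitmx) unitmxE dA unitr1.
by apply: (mulIr uA); rewrite -exprSr prednK ?prime_gt0 // mul1r.
Qed.

Lemma mx2_exp_nonsplit (A : 'M['F_p]_2) : \det A = 1 ->
  ((\tr A) ^+ 2 - 4) ^+ p./2 = - 1 -> A ^+ p.+1 = 1.
Proof.
move=> dA; have := Frobenius_mx2 A; rewrite dA mulr1 => + e1.
rewrite e1 scaleN1r => Ap.
have {}Ap : A ^+ p = (\tr A)%:M - A.
  apply: (scalerI two_neq0); rewrite Ap scalerBr opprB addrA.
  by congr (_ - _); rewrite scaler_nat mulr2n.
by rewrite exprSr Ap -[LHS]/(_ *m _) mulmx_adj2 dA.
Qed.

(** Otherwise all p - 1 nonzero elements are roots of X^((p-1)/2) - 1. *)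
Lemma exists_nonresidue : exists2 w : 'F_p, w != 0 & w ^+ p./2 != 1.
Proof.
apply/exists_inP/contraT; rewrite negb_exists_in => /forall_inP all1.
pose rs := enum [pred w : 'F_p | w != 0].
have k_gt0 : (0 < p./2)%N by lia.
have := @max_poly_roots _ ('X^(p./2) - 1) rs _ _ (enum_uniq _).
rewrite -cardE size_XnsubC // => /(_ _ _)/wrap[].
- by rewrite -size_poly_eq0 size_XnsubC.
- apply/allP=> w; rewrite mem_enum => /all1/negbNE/eqP w1.
  by rewrite /root !hornerE w1 subrr.
rewrite cardC1 card_Fp //; lia.
Qed.

(** If 4 - t^2 = (2 - t)(2 + t) were never a nonresidue, then, rescaling, two
    nonzero elements with nonzero sum would always have the same character: all
    characters would be 1. *)
Lemma exists_nonresidue_4B : exists t : 'F_p, (4 - t ^+ 2) ^+ p./2 = - 1.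
Proof.
suff /existsP[t /eqP Nt] : [exists t : 'F_p, (4 - t ^+ 2) ^+ p./2 == - 1].
  by exists t.
apply/contraT; rewrite negb_exists => /forallP/= noN.
have mul1 (w w' : 'F_p) :
    w != 0 -> w' != 0 -> w + w' != 0 -> (w * w') ^+ p./2 = 1.
  move=> w0 w'0 ww'0; have [//|N] := half_exp_sign (mulf_neq0 w0 w'0).
  have /eqP[] := noN (2 * (w - w') / (w + w')).
  rewrite four_sub_sqr //.
  rewrite exprMn sqr_half_exp ?mul1r // mulf_neq0 ?invr_eq0 //.
  by rewrite (natrM _ 2 2) mulf_neq0.
have [w w0 /eqP[]] := exists_nonresidue.
have [w1|w1] := eqVneq (w + 1) 0; last first.
  by have := mul1 w 1 w0 (oner_neq0 _) w1; rewrite mulr1.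
(* -1 cannot be compared to 1 directly, but it can be to the square 4. *)
have -> : w = -1 by apply/eqP; rewrite -subr_eq0 opprK w1.
have four : 4 = 2 ^+ 2 :> 'F_p by ring.
have four_neq0 : 4 != 0 :> 'F_p by rewrite four expf_neq0.
have := mul1 (-1) 4; rewrite exprMn [in 4 ^+ _]four sqr_half_exp // mulr1.
apply=> //; first by rewrite oppr_eq0 oner_eq0.
rewrite (_ : -1 + 4 = 3%:R); last by ring.
by rewrite natr_Fp_neq0 // gtnNdvd.
Qed.

(** The trace of the product is chosen as tau^2 - 2, so that the product is the
    square of an element M of trace tau. With 4 - tau^2 a nonresidue, the
    character of tau^2 - 4 is the opposite of that of -1, so M has exponent p - 1
    or p + 1, whichever is not divisible by 4. *)
Lemma exists_trace_transvections : exists2 t : 'F_p, t != 0 &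
  (upper 1 *m lower t) ^+ (if odd p./2 then p./2 else p./2.+1) = 1.
Proof.
set k := p./2; have [tau tauN] := exists_nonresidue_4B.
have N1 : -1 != 1 :> 'F_p.
  by rewrite eq_sym -subr_eq0 opprK (_ : 1 + 1 = 2%:R) //; ring.
have tau0 : tau != 0.
  apply: contraNneq N1 => tau0; rewrite -tauN tau0 expr0n subr0.
  by rewrite (_ : 4 = 2 ^+ 2) ?sqr_half_exp //; ring.
exists (tau ^+ 2 - 4).
  apply/eqP=> t0; move/eqP: tauN; rewrite -opprB t0 oppr0 expr0n.
  have -> /= : (p./2 == 0)%N = false by lia.
  by rewrite eq_sym oppr_eq0 oner_eq0.
have [M [dM trM <-]] := sqrt_mul_upper_lower tau0.
have sgn : ((\tr M) ^+ 2 - 4) ^+ k = (-1) ^+ k * -1.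
  by rewrite trM -[X in _ * X]tauN -exprMn mulN1r opprB.
rewrite -exprM; have [ok|ok] := boolP (odd k).
  rewrite (_ : 2 * k = p.-1)%N; last by lia.
  by apply: mx2_exp_split => //; rewrite sgn -signr_odd ok expr1 mulrNN mulr1.
rewrite (_ : 2 * k.+1 = p.+1)%N; last by lia.
by apply: mx2_exp_nonsplit => //; rewrite sgn -signr_odd (negbTE ok) expr0 mul1r.
Qed.

Lemma coprime_exponents : if odd p./2 then coprime (p * p./2) p.+1
  else coprime (p * p./2.+1) p.-1.
Proof.
set k := p./2.
have step (m : nat) : odd m -> coprime m (2 * m.+1) /\ coprime m (2 * m.-1).
  move=> om; rewrite !coprimeMr !coprimen2 om coprimenS coprime_sym.
  by rewrite coprimePn ?odd_gt0.
have pk : (p - 1 = 2 * k)%N by lia.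
have cp : coprime p p.+1 /\ coprime p p.-1.
  by rewrite coprimenS coprime_sym coprimePn ?prime_gt0.
have [ok|ok] := boolP (odd k); rewrite coprimeMl.
  rewrite cp.1 (_ : p.+1 = 2 * k.+1)%N; last by lia.
  by have [] := step _ ok.
rewrite cp.2 (_ : p.-1 = 2 * k.+1.-1)%N; last by lia.
by have [] := step k.+1 ok.
Qed.

End Characters.

(** * Generating SL(2,p) by transvections *)

Section SL2.
Variable p : nat.
Hypothesis pr_p : prime p.
Implicit Types (A B : SL2 p) (M N : 'M['F_p]_2) (b r s t x y : 'F_p).

Definition mx_of_SL2 A : 'M['F_p]_2 := GLval (sgval A).

Definition SL2_of_mx M : SL2 p :=
  subg (SL2_group p) (insubd (1%g : {'GL_2['F_p]}) M).

Lemma mx_of_SL2K M : \det M = 1 -> mx_of_SL2 (SL2_of_mx M) = M.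
Proof.
move=> dM.
have eM : GLval (insubd (1%g : {'GL_2['F_p]}) M) = M.
  by rewrite val_insubd -[_ \is a _]/(M \in unitmx) unitmxE dM unitr1.
by rewrite /mx_of_SL2 subgK // inE eM dM.
Qed.

Lemma mx_of_SL2_inj : injective mx_of_SL2.
Proof. by move=> A B eAB; apply: val_inj; apply: val_inj. Qed.

Lemma det_SL2 A : \det (mx_of_SL2 A) = 1.
Proof. by have := subgP A; rewrite inE => /eqP. Qed.

Lemma mx_of_SL2M A B : mx_of_SL2 (A * B)%g = mx_of_SL2 A *m mx_of_SL2 B.
Proof. by []. Qed.

Lemma mx_of_SL2X A n : mx_of_SL2 (A ^+ n)%g = mx_of_SL2 A ^+ n.
Proof. by elim: n => // n IHn; rewrite expgS mx_of_SL2M IHn exprS. Qed.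

Lemma SL2_of_mxK A : SL2_of_mx (mx_of_SL2 A) = A.
Proof. by apply: mx_of_SL2_inj; rewrite mx_of_SL2K ?det_SL2. Qed.

Lemma SL2_of_mxM M N : \det M = 1 -> \det N = 1 ->
  SL2_of_mx (M *m N) = (SL2_of_mx M * SL2_of_mx N)%g.
Proof.
move=> dM dN; apply: mx_of_SL2_inj.
by rewrite mx_of_SL2M !mx_of_SL2K // det_mulmx dM dN mulr1.
Qed.

Lemma SL2_of_mxX M n : \det M = 1 -> SL2_of_mx (M ^+ n) = (SL2_of_mx M ^+ n)%g.
Proof.
move=> dM; apply: mx_of_SL2_inj; rewrite mx_of_SL2X !mx_of_SL2K //.
by elim: n => [|n IHn]; rewrite ?det1 // exprS det_mulmx dM IHn mulr1.
Qed.

Lemma SL2_of_mx_exp M n :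
  \det M = 1 -> M ^+ n = 1 -> (SL2_of_mx M ^+ n)%g = 1%g.
Proof.
by move=> dM Mn; apply: mx_of_SL2_inj; rewrite mx_of_SL2X mx_of_SL2K // Mn.
Qed.

Section Generation.
Variable H : {group SL2 p}.

Lemma upper_mem s b : s != 0 ->
  SL2_of_mx (upper s) \in H -> SL2_of_mx (upper b) \in H.
Proof.
move=> s0 Hs; have -> : upper b = upper s ^+ (b / s : 'F_p).
  by rewrite upperX -mulr_natr natr_Zp mulrC divfK.
by rewrite SL2_of_mxX ?det_upper // groupX.
Qed.

Lemma lower_mem s b : s != 0 ->
  SL2_of_mx (lower s) \in H -> SL2_of_mx (lower b) \in H.
Proof.
move=> s0 Hs; have -> : lower b = lower s ^+ (b / s : 'F_p).
  by rewrite lowerX -mulr_natr natr_Zp mulrC divfK.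
by rewrite SL2_of_mxX ?det_lower // groupX.
Qed.

(** The field being prime, [H] contains all upper and lower transvections, hence
    the big Bruhat cell; a matrix outside the big cell is moved into it by a
    lower transvection. *)
Lemma transvections_gen s t : s != 0 -> t != 0 ->
  SL2_of_mx (upper s) \in H -> SL2_of_mx (lower t) \in H ->
  H :=: [set: SL2 p]%SET.
Proof.
move=> s0 t0 /(upper_mem _ s0) HU /(lower_mem _ t0) HL.
have cell M : \det M = 1 -> M 1 0 != 0 -> SL2_of_mx M \in H.
  move=> dM M10; rewrite (big_cell dM M10).
  have dU b := det_upper b; have dL := det_lower (M 1 0).
  by rewrite !SL2_of_mxM ?groupM ?det_mulmx ?dU ?dL ?mulr1.
apply/eqP; rewrite eqEsubset subsetT; apply/subsetP=> A _.
have [A10|] := eqVneq (mx_of_SL2 A 1 0) 0; last first.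
  by move=> c0; rewrite -[A]SL2_of_mxK cell ?det_SL2.
rewrite -(groupMl _ (HL 1)) -[A]SL2_of_mxK -SL2_of_mxM ?det_SL2 ?det_lower //.
apply: cell; first by rewrite det_mulmx det_SL2 det_lower mulr1.
move: (det_SL2 A) A10; rewrite (mx2_eta (mx_of_SL2 A)).
move: (_ 0 0) (_ 0 1) (_ 1 0) (_ 1 1) => a b c d.
rewrite !mx2E !mx2_entry /= => dA c0.
apply/eqP=> ac0; have /eqP := oner_neq0 'F_p; apply; rewrite -dA c0.
have -> : a = 0 by rewrite -ac0 c0; ring.
by ring.
Qed.

End Generation.

Lemma gen_upper_lower t : t != 0 ->
  <<[set SL2_of_mx (upper 1%R); SL2_of_mx (lower t)]>>%g = [set: SL2 p]%SET.
Proof.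
move=> t0; apply: (transvections_gen (oner_neq0 _) t0).
  by rewrite mem_gen ?set21.
by rewrite mem_gen ?set22.
Qed.

Lemma gen_companion x r : r != 0 ->
  <<[set SL2_of_mx (companion x r); SL2_of_mx (upper 1 *m companion x r)%R]>>%g
   = [set: SL2 p]%SET.
Proof.
move=> r0; set a := SL2_of_mx (companion x r).
have da := det_companion x r0; have dw := det_companion 0 r0.
have du : \det (upper 1 : 'M['F_p]_2) = 1 := det_upper 1.
rewrite (SL2_of_mxM du da) -/a.
set u := SL2_of_mx (upper 1); pose H := <<[set a; (u * a)%g]>>%G.
have Ha : a \in H by rewrite mem_gen ?set21.
have Hu : u \in H by rewrite -(groupMr _ Ha) mem_gen ?set22.
have HU b := upper_mem b (oner_neq0 _) Hu.
(* Up to an upper transvection, a is antidiagonal, so that conjugation by it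
   turns u into a lower transvection. *)
pose w := SL2_of_mx (companion 0 r).
have Hw : w \in H.
  rewrite -(groupMr w (HU (x / r))) -(SL2_of_mxM dw (det_upper _)).
  rewrite (companion_mul_upper x r0); exact: Ha.
have nr2 : - r ^+ 2 != 0 by rewrite oppr_eq0 expf_neq0.
apply: (transvections_gen (H := H) (oner_neq0 _) nr2 Hu).
rewrite -(groupMr _ Hw) -(SL2_of_mxM (det_lower _) dw) (companion_conj_upper r0).
rewrite (SL2_of_mxM dw du); exact: groupM Hw Hu.
Qed.

(** * The two triples *)

Lemma coprime_beauville_SL2_of_traces n q t x y :
    coprime (p * n) q -> t != 0 -> x != y ->
    (upper 1 *m lower t) ^+ n = 1 ->
    (forall M, \det M = 1 ->
       [|| \tr M == x, \tr M == y | \tr M == x * y - 2] -> M ^+ q = 1) ->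
  coprime_beauville (SL2 p).
Proof.
move=> co t0 xy Cn trq; pose r := y - x.
have r0 : r != 0 by rewrite subr_eq0 eq_sym.
have xr : x + r = y by rewrite addrC subrK.
pose a := companion x r.
have da : \det a = 1 := det_companion x r0.
have du : \det (upper 1 : 'M['F_p]_2) = 1 := det_upper 1.
have dl := det_lower t.
have dc : \det (upper 1 *m a) = 1 by rewrite det_mulmx du da mulr1.
have dac : \det (a *m (upper 1 *m a)) = 1 by rewrite det_mulmx da dc mulr1.
have dul : \det (upper 1 *m lower t) = 1 by rewrite det_mulmx du dl mulr1.
have charp := pchar_Fp pr_p.
exists (p * n)%N, q, (SL2_of_mx (upper 1)), (SL2_of_mx (lower t)),
  (SL2_of_mx a), (SL2_of_mx (upper 1 *m a)); split=> //.
- split.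
  + apply: (SL2_of_mx_exp du).
    by rewrite upperX mulrnA (mulrn_pchar charp) mul0rn [RHS]mx2_1.
  + apply: (SL2_of_mx_exp dl).
    by rewrite lowerX mulrnA (mulrn_pchar charp) mul0rn [RHS]mx2_1.
  + rewrite -(SL2_of_mxM du dl); apply: (SL2_of_mx_exp dul).
    by rewrite mulnC exprM Cn expr1n.
- split.
  + apply: (SL2_of_mx_exp da); apply: (trq a da).
    by rewrite mxtrace_companion eqxx.
  + apply: (SL2_of_mx_exp dc); apply: trq dc _.
    by rewrite mxtrace_upper_companion xr eqxx orbT.
  + rewrite -(SL2_of_mxM da dc); apply: (SL2_of_mx_exp dac).
    apply: trq dac _; rewrite (mxtrace_companion_upper_companion x r0) xr.
    by rewrite eqxx !orbT.
- exact: gen_upper_lower.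
exact: gen_companion.
Qed.

Lemma coprime_beauville_SL2_generic :
  (3 < p)%N -> p != 5%N -> p != 13%N -> coprime_beauville (SL2 p).
Proof.
move=> p_gt3 p5 p13.
have [t t0 Ct] := exists_trace_transvections pr_p p_gt3.
have p_neq0 q : prime q -> p != q -> q%:R != 0 :> 'F_p.
  by move=> pr_q pq; rewrite natr_Fp_neq0 // dvdn_prime2.
have two0 : 2 != 0 :> 'F_p by rewrite p_neq0 // gtn_eqF // ltnW.
have three0 : 3 != 0 :> 'F_p by rewrite p_neq0 // gtn_eqF.
have five0 : 5 != 0 :> 'F_p by rewrite p_neq0.
have thirteen0 : 13 != 0 :> 'F_p by rewrite p_neq0.
have := rational_traces five0 thirteen0.
set x := - 10 / 13; set y := - 8 / 5 => -[xBy xyx x2 y2].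
have xy : x != y.
  rewrite -subr_eq0 xBy; apply: mulf_neq0; rewrite ?invr_eq0 mulf_neq0 //.
  exact: expf_neq0.
have sgn z : [|| z == x, z == y | z == x * y - 2] ->
    (z ^+ 2 - 4) ^+ p./2 = (-1) ^+ p./2.
  have sq (r : 'F_p) : r != 0 -> (- r ^+ 2) ^+ p./2 = (-1) ^+ p./2.
    by move=> r0; rewrite [LHS]exprNn (sqr_half_exp pr_p p_gt3 r0) mulr1.
  have x0 : 2 ^+ 3 * 3 / 13 != 0 :> 'F_p.
    rewrite mulf_neq0 ?invr_eq0 // mulf_neq0 //; exact: expf_neq0.
  have y0 : 2 * 3 / 5 != 0 :> 'F_p.
    by rewrite mulf_neq0 ?invr_eq0 // mulf_neq0.
  rewrite xyx => /or3P[]/eqP->; rewrite ?x2 ?y2; [exact: sq x0|exact: sq y0|].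
  exact: sq x0.
have := coprime_exponents pr_p p_gt3.
move: Ct; have [ok|ok] := boolP (odd p./2) => Ct co.
  apply: (coprime_beauville_SL2_of_traces co t0 xy Ct) => M dM /sgn sM.
  by apply: mx2_exp_nonsplit; rewrite // sM -signr_odd ok.
apply: (coprime_beauville_SL2_of_traces co t0 xy Ct) => M dM /sgn sM.
by apply: mx2_exp_split; rewrite // sM -signr_odd (negbTE ok).
Qed.

End SL2.

(** Here the product of the transvections has trace -1, hence order 3, and
    3^2 - 4 = 5 and 6^2 - 4 = 6 are nonresidues modulo 13. *)
Lemma coprime_beauville_SL2_13 : coprime_beauville (SL2 13).
Proof.
apply: (@coprime_beauville_SL2_of_traces 13 _ 3 14 (-3) 3 6) => //.
  rewrite mul_upper_lower !exprS expr0 mulr1 -![_ * _]/(_ *m _) !mx2E mx2_1.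
  by congr (mx2 _ _ _ _); apply/eqP.
move=> M dM trM; apply: (@mx2_exp_nonsplit 13) => //.
by move: trM => /or3P[]/eqP ->; apply/eqP.
Qed.

Lemma coprime_beauville_SL2 p :
  prime p -> (3 < p)%N -> p != 5%N -> coprime_beauville (SL2 p).
Proof.
move=> pr_p p_gt3 p5; have [->|p13] := eqVneq p 13%N.
  exact: coprime_beauville_SL2_13.
exact: coprime_beauville_SL2_generic.
Qed.

Local Close Scope ring_scope.

Theorem theorem1p3 (R : realType) (p : nat) :
  prime p -> p != 2 -> p != 3 -> p != 5 ->
  forall G : finGroupType, G = SL2 p \/ G = PSL2 p ->
  exists v : quadruple G,
    unmixed_beauville_structure v /\
    unmixed_beauville_surface G (beauville_surface R v).
Proof.
move=> pr_p p2 p3 p5 G GE.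
have p_gt3 : (3 < p)%N.
  by have := prime_gt1 pr_p; move: p2 p3; case: p {pr_p p5 GE} => [|[|[|[|]]]].
have cb := coprime_beauville_SL2 pr_p p_gt3 p5.
have [v vB] : exists v : quadruple G, unmixed_beauville_structure v.
  apply: beauville_of_coprime_exponents.
  case: GE => ->; first exact: cb.
  exact: coprime_beauville_coset (center_normal _) cb.
by exists v; split=> //; exists v; split=> //; exact: biholomorphic_refl.
Qed.
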